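(* Let $\ell \geq 2$ and let $G$ be a $K_{\ell}$-critical graph with $\chi(G) \leq 2\ell + 1$. Then $G$ is a complete graph.
   Context: All graphs are finite and simple. $\chi(G)$ denotes the chromatic number. For $\ell \geq 2$, a graph $G$ is called $K_{\ell}$-critical if (i) $G$ contains $K_{\ell}$ as a subgraph; (ii) $G$ is critical, i.e. removing any vertex reduces the chromatic number of $G$ by one; (iii) removing the vertex set of any copy of $K_{\ell}$ in $G$ reduces the chromatic number of $G$ by exactly $\ell$. *)

(* Defs.v *)
From mathcomp Require Import all_boot.

Set Implicit Arguments.
Unset Strict Implicit.
Unset Printing Implicit Defensive.

Record sgraph := SGraph {
  vertex :> finType;
  edge : rel vertex;
  edge_sym : symmetric edge;
  edge_irrefl : irreflexive edge }.

(* The vertex type of the induced subgraph is a genuine subtype, so that the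
   graph on the empty vertex set is 0-colorable. *)
Section Induced.
Variables (G : sgraph) (S : {set G}).

Definition induced_edge : rel {x : G | x \in S} :=
  fun x y => edge (val x) (val y).

Lemma induced_edge_sym : symmetric induced_edge.
Proof. by move=> x y; apply: edge_sym. Qed.

Lemma induced_edge_irrefl : irreflexive induced_edge.
Proof. by move=> x; apply: edge_irrefl. Qed.

Definition induced : sgraph := SGraph induced_edge_sym induced_edge_irrefl.
End Induced.

Definition del_set (G : sgraph) (S : {set G}) : sgraph := induced (~: S).

Definition proper_coloring (G : sgraph) (k : nat) (f : {ffun G -> 'I_k}) : bool :=
  [forall x, forall y, edge x y ==> (f x != f y)].

Definition colorable (G : sgraph) (k : nat) : bool :=
  [exists f : {ffun G -> 'I_k}, proper_coloring f].

Lemma colorable_card (G : sgraph) : exists k, colorable G k.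
Proof.
exists #|G|; apply/existsP; exists [ffun x => enum_rank x].
apply/forallP=> x; apply/forallP=> y; apply/implyP=> exy.
rewrite !ffunE; apply: contraTneq exy => /enum_rank_inj ->.
by rewrite edge_irrefl.
Qed.

Definition chromatic_number (G : sgraph) : nat := ex_minn (colorable_card G).

Notation "\chi G" := (chromatic_number G) (at level 10, G at level 8).

Definition is_clique (G : sgraph) (K : {set G}) : Prop :=
  forall x y, x \in K -> y \in K -> x != y -> edge x y.

(* The vertex sets of the copies of K_l in G. *)
Definition is_copy_of_K (G : sgraph) (l : nat) (K : {set G}) : Prop :=
  #|K| = l /\ is_clique K.

Definition critical (G : sgraph) : Prop :=
  forall v : G, \chi (del_set [set v]) + 1 = \chi G.

Definition K_critical (l : nat) (G : sgraph) : Prop :=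
  [/\ exists K : {set G}, is_copy_of_K l K,
      critical G
    & forall K : {set G}, is_copy_of_K l K -> \chi (del_set K) + l = \chi G].

Definition complete_graph (G : sgraph) : Prop :=
  forall x y : G, x != y -> edge x y.

(* Main.v *)
Require Import Defs.
From mathcomp Require Import all_boot.

Set Implicit Arguments.
Unset Strict Implicit.
Unset Printing Implicit Defensive.

(** Let [k] be the chromatic number and [L] an [l]-clique. In every
    [(k - l)]-coloring of [G - L], each color class contains a common neighbor of
    [L]; so a vertex of [L] can be swapped for a common neighbor, in many ways.
    If there is no [k]-clique, swapping leads out of any clique [W], so that [W]
    is disjoint from some [l]-clique and has at most [k - l] vertices. As there is
    an [(l + 1)]-clique, only [k = 2l + 1] with clique number [l + 1] remains.

    In that case fix an [l]-clique [P] and an [(l + 1)]-coloring [f] of [G - P].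
    Among disjoint [l]-cliques [Z], [L] linked by swaps avoiding [P], maximize the
    set of [l]-cliques reachable from [L] by swaps avoiding both [P] and [Z].
    Maximality forces these cliques to cover all common neighbors of [Z] outside
    [P]. Colors propagate uniquely along swaps, so there any [(l + 1)]-coloring
    of [G - Z] agrees with [f] up to renaming, and [f] is constant on the common
    neighbors of [Z] outside [P]. At most one common neighbor of [Z] lies in [P],
    hence at most two, and so not all, of the [l + 1] colors occur among them. *)

(** * Disjoint sets and paths leaving a set *)

Lemma disjointP (T : finType) (A B : {set T}) :
  reflect (forall x, x \in A -> x \in B -> False) [disjoint A & B].
Proof.
rewrite disjoint_subset; apply: (iffP subsetP) => AB x xA.
  by move=> xB; have := AB x xA; rewrite inE xB.
by rewrite inE; apply/negP; apply: AB.
Qed.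

Lemma connect_exit (T : finType) (e : rel T) (M : {pred T}) x y :
  connect e x y -> x \in M -> y \notin M ->
  exists a b, [/\ a \in M, b \notin M & e a b].
Proof.
case/connectP=> p; elim: p x => [|z p IHp] x /= => [_ -> -> //|].
case/andP=> exz pathz yE xM yM; have [zM | zM] := boolP (z \in M).
  exact: IHp pathz yE zM yM.
by exists x, z.
Qed.

(** * Colorings outside a deleted vertex set *)

Section Coloring.
Variable G : sgraph.
Implicit Types (F K S W L : {set G}) (f g : G -> nat).

(** Defined on all of [G] but constrained only outside [F], so that colorings of different subgraphs
    can be compared without transport between subtypes. *)
Definition coloring_off F n f :=
  (forall x, x \notin F -> f x < n) /\
  (forall x y, x \notin F -> y \notin F -> edge x y -> f x <> f y).

Lemma coloring_offS F F' n f :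
  F \subset F' -> coloring_off F n f -> coloring_off F' n f.
Proof.
move=> sFF' [f_lt f_proper].
have nF x : x \notin F' -> x \notin F by apply: contra => /(subsetP sFF').
by split=> [x /nF/f_lt | x y /nF xF /nF yF]; last exact: f_proper.
Qed.

Lemma ex_coloring_off S : exists f, coloring_off S (\chi (del_set S)) f.
Proof.
rewrite /chromatic_number; case: ex_minnP => n /existsP[h /forallP h_proper] _.
pose f (x : G) : nat :=
  if insub x is Some u then h (u : del_set S) : nat else 0.
have fE x (xS : x \in ~: S) : f x = h (Sub x xS : del_set S).
  by rewrite /f insubT.
exists f; split=> [x | x y]; rewrite -!in_setC => xS; first by rewrite fE.
move=> yS exy; rewrite !fE => /val_inj eq_h.
move/(_ (Sub x xS : del_set S))/forallP: h_proper => /(_ (Sub y yS)).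
by rewrite eq_h eqxx /= implybF => /negP; apply.
Qed.

(** The palette may be any listed set of colors, which permits the mix of numbers and vertices in
    [common_nbr_of_color]. *)
Lemma chromatic_number_le_size (T : eqType) (s : seq T) (f : G -> T) :
  (forall x, f x \in s) -> (forall x y, edge x y -> f x <> f y) ->
  \chi G <= size s.
Proof.
move=> fs f_proper; rewrite /chromatic_number; case: ex_minnP => n _; apply.
have f_lt x : index (f x) s < size s by rewrite index_mem.
apply/existsP; exists [ffun x => Ordinal (f_lt x)].
apply/forallP=> x; apply/forallP=> y; apply/implyP=> exy; rewrite !ffunE.
apply/eqP=> -[eq_ind]; case: (f_proper _ _ exy).
by rewrite -(nth_index (f x) (fs x)) eq_ind nth_index.
Qed.

(** * Cliques and their colors *)

Definition cliqueb K := [forall x in K, forall y in K, (x != y) ==> edge x y].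

Lemma cliqueP K : reflect (is_clique K) (cliqueb K).
Proof.
apply: (iffP forall_inP) => [K_cl x y xK yK xy | K_cl x xK].
  by move/forall_inP: (K_cl x xK) => /(_ y yK) /implyP; apply.
by apply/forall_inP=> y yK; apply/implyP; apply: K_cl.
Qed.

Lemma sub_clique K W : K \subset W -> cliqueb W -> cliqueb K.
Proof.
move=> /subsetP sKW /cliqueP W_cl; apply/cliqueP=> x y /sKW xW /sKW yW.
exact: W_cl.
Qed.

Lemma clique_coloring_inj F n f W :
  coloring_off F n f -> cliqueb W -> [disjoint W & F] -> {in W &, injective f}.
Proof.
move=> [_ f_proper] /cliqueP W_cl /disjointFr W_F x y xW yW eq_f.
apply/eqP; apply: contraT => xy.
by case: (f_proper x y _ _ _ eq_f); rewrite ?W_F //; apply: W_cl.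
Qed.

Lemma clique_colors_uniq F n f W :
  coloring_off F n f -> cliqueb W -> [disjoint W & F] ->
  uniq [seq f x | x <- enum W] /\ {subset [seq f x | x <- enum W] <= iota 0 n}.
Proof.
move=> f_col W_cl W_F; split.
  rewrite map_inj_in_uniq ?enum_uniq // => x y; rewrite !mem_enum.
  exact: (clique_coloring_inj f_col).
move=> i /mapP[x]; rewrite mem_enum => xW ->; rewrite mem_iota /=.
by case: f_col => f_lt _; apply: f_lt; rewrite (disjointFr W_F).
Qed.

Lemma card_clique_le F n f W :
  coloring_off F n f -> cliqueb W -> [disjoint W & F] -> #|W| <= n.
Proof.
move=> f_col W_cl W_F; have [f_uniq f_sub] := clique_colors_uniq f_col W_cl W_F.
by have := uniq_leq_size f_uniq f_sub; rewrite size_map size_iota -cardE.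
Qed.

Lemma clique_all_colors F n f W i :
  coloring_off F n f -> cliqueb W -> [disjoint W & F] -> n <= #|W| -> i < n ->
  exists2 x, x \in W & f x = i.
Proof.
move=> f_col W_cl W_F le_nW lt_in.
have [f_uniq f_sub] := clique_colors_uniq f_col W_cl W_F.
have le_size : size (iota 0 n) <= size [seq f x | x <- enum W].
  by rewrite size_map size_iota -cardE.
have [_ eq_mem] := uniq_min_size f_uniq f_sub le_size.
have : i \in iota 0 n by rewrite mem_iota.
by rewrite -eq_mem => /mapP[x]; rewrite mem_enum => xW ->; exists x.
Qed.

(** * Common neighbors of a vertex set *)

Definition common_nbrs K : {set G} := [set u | [forall x in K, edge u x]].

Lemma common_nbrsP K u :
  reflect (forall x, x \in K -> edge u x) (u \in common_nbrs K).
Proof. by rewrite inE; apply: forall_inP. Qed.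

Lemma common_nbrs_notin K u : u \in common_nbrs K -> u \notin K.
Proof. by move/common_nbrsP=> uK; apply/negP=> /uK; rewrite edge_irrefl. Qed.

Lemma common_nbr_clique K u :
  cliqueb K -> u \in common_nbrs K -> cliqueb (u |: K).
Proof.
move=> /cliqueP K_cl /common_nbrsP uK; apply/cliqueP=> x y.
case/setU1P=> [-> | xK] /setU1P[-> | yK]; first by rewrite eqxx.
- by move=> _; apply: uK.
- by move=> _; rewrite edge_sym; apply: uK.
exact: K_cl.
Qed.

(* Otherwise every vertex of color [i] could join the class of a non-neighbor
   in [K], and the color [i] would be saved. *)
Lemma common_nbr_of_color K q f i :
  \chi G = q + #|K| -> coloring_off K q f -> i < q ->
  exists2 u, u \in common_nbrs K & f u = i.
Proof.
move=> chiG [f_lt f_proper] lt_iq.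
case: (pickP [pred u | (u \in common_nbrs K) && (f u == i)]) => [u | none].
  by case/andP=> uK /eqP fu; exists u.
pose non_nbr u := [pick x | (x \in K) && ~~ edge u x].
(* Each vertex of [K] becomes a color of its own, and the class [i] is spread over these colors. By
   [none] the fallback [inr u] for [u] outside [K] never occurs. *)
pose h u : nat + G :=
  if u \in K then inr u
  else if f u == i then (if non_nbr u is Some x then inr x else inr u)
  else inl (f u).
have non_nbrE u : u \notin K -> f u = i ->
    exists2 x, non_nbr u = Some x & (x \in K) && ~~ edge u x.
  move=> uK fu; rewrite /non_nbr; case: pickP => [x xP | all_nbr].
    by exists x.
  have := none u; rewrite /= fu eqxx andbT => /negP[]; apply/common_nbrsP=> x xK.
  by have := all_nbr x; rewrite /= xK => /negbFE.
have hE u : [\/ u \in K /\ h u = inr u,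
     u \notin K /\ f u = i /\ (exists x, [/\ h u = inr x, x \in K & ~~ edge u x])
   | u \notin K /\ f u <> i /\ h u = inl (f u)].
  rewrite /h; case: ifP => uK; first by constructor 1.
  case: eqP => fu; last by constructor 3.
  have [x -> /andP[xK xu]] := non_nbrE _ (negbT uK) fu.
  by constructor 2; do 2!split => //; exists x.
pose s : seq (nat + G) :=
  map inl (rem i (iota 0 q)) ++ map inr (enum K).
have size_s : size s = q.-1 + #|K|.
  by rewrite size_cat !size_map size_rem ?mem_iota ?size_iota // -cardE.
suff : \chi G <= size s.
  by rewrite size_s chiG leq_add2r; case: q lt_iq {chiG f_lt s size_s} => //= q _;
     rewrite ltnn.
apply: (chromatic_number_le_size (f := h)) => [x | x y exy].
  rewrite mem_cat; have inj_inl : injective (@inl nat G) by move=> ? ? [].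
  have inj_inr : injective (@inr nat G) by move=> ? ? [].
  case: (hE x) => [[xK ->] | [xK [fx [z [-> zK _]]]] | [xK [fx ->]]].
  - by rewrite orbC mem_map ?mem_enum ?xK.
  - by rewrite orbC mem_map ?mem_enum ?zK.
  by rewrite mem_map // mem_rem_uniq ?iota_uniq // inE mem_iota f_lt // andbT;
     move/eqP: fx => ->.
case: (hE x) => [[xK ->] | [xK [fx [z [-> zK xz]]]] | [xK [fx ->]]];
case: (hE y) => [[yK ->] | [yK [fy [t [-> tK yt]]]] | [yK [fy ->]]] //.
- by case=> eq_xy; move: exy; rewrite eq_xy edge_irrefl.
- by case=> eq_xt; move: exy yt; rewrite eq_xt edge_sym => ->.
- by case=> eq_zy; move: exy xz; rewrite eq_zy => ->.
- by have := f_proper _ _ xK yK exy; rewrite fx fy.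
by case; apply: f_proper.
Qed.

Lemma card_common_nbrs K q f :
  \chi G = q + #|K| -> coloring_off K q f -> q <= #|common_nbrs K|.
Proof.
move=> chiG f_col.
have sub_f : {subset iota 0 q <= [seq f u | u <- enum (common_nbrs K)]}.
  move=> i; rewrite mem_iota => /= lt_iq.
  have [u uK <-] := common_nbr_of_color chiG f_col lt_iq.
  by rewrite map_f ?mem_enum.
by have := uniq_leq_size (iota_uniq 0 q) sub_f; rewrite size_map size_iota -cardE.
Qed.

End Coloring.

(** * Swaps between [l]-cliques *)

Section CliqueSwaps.
Variables (G : sgraph) (l : nat).
Implicit Types (F S A B K L P W Z : {set G}) (f g : G -> nat).

Definition kclique K := (#|K| == l) && cliqueb K.

Lemma kcliqueP K : reflect (is_copy_of_K l K) (kclique K).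
Proof. by apply: (iffP andP) => -[] /eqP cardK /cliqueP. Qed.

(** The bound on the union means that [A] and [B] are equal or differ by trading one vertex for an
    adjacent one. *)
Definition swap F : rel {set G} := fun A B =>
  [&& kclique A && kclique B, [disjoint A & F], [disjoint B & F],
      cliqueb (A :|: B) & #|A :|: B| <= l.+1].

Lemma swap_sym F : symmetric (swap F).
Proof.
by move=> A B; rewrite /swap [A :|: B]setUC [kclique A && _]andbC; bool_congr;
   rewrite andbCA.
Qed.

Lemma swap_connect_sym F : connect_sym (swap F).
Proof. exact: sym_connect_sym (swap_sym F). Qed.

Lemma connect_swapP F L L' :
  connect (swap F) L L' -> kclique L -> [disjoint L & F] ->
  kclique L' /\ [disjoint L' & F].
Proof.
move=> /connectP[p]; elim: p L => [|A p IHp] L /= => [_ -> //|].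
case/andP=> /and5P[/andP[_ A_cl] _ A_F _ _] pathA L'E _ _.
exact: IHp pathA L'E A_cl A_F.
Qed.

Lemma swap_kclique F L u x :
  kclique L -> [disjoint L & F] -> u \in common_nbrs L -> u \notin F ->
  x \in L -> swap F L (u |: (L :\ x)).
Proof.
move=> L_kcl L_F uL uF xL; have uNL := common_nbrs_notin uL.
have /andP[/eqP cardL L_cl] := L_kcl.
have uL_cl := common_nbr_clique L_cl uL.
have sub_uL : u |: (L :\ x) \subset u |: L by rewrite setUS ?subsetDl.
have LU : L :|: (u |: (L :\ x)) = u |: L.
  by rewrite setUCA (setUidPl (subsetDl _ _)).
apply/and5P; split=> //; last 2 first.
- by rewrite LU.
- by rewrite LU cardsU1 uNL cardL.
- rewrite L_kcl /= /kclique (sub_clique sub_uL uL_cl) andbT cardsU1 !inE.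
  by rewrite (negbTE uNL) andbF /= -cardL [in #|L|](cardsD1 x) xL.
rewrite disjoint_sym; apply/disjointP=> y yF /setU1P[yu | /setD1P[_ yL]].
  by rewrite -yu yF in uF.
by rewrite (disjointFr L_F yL) in yF.
Qed.

(** Trading a vertex of [S] for a common neighbor outside [F] and [S] strictly lowers
    [#|L :&: S|]. *)
Lemma escape F S L :
  kclique L -> [disjoint L & F] ->
  (forall L', kclique L' -> [disjoint L' & F] ->
     exists2 u, u \in common_nbrs L' & (u \notin F) && (u \notin S)) ->
  exists2 L', connect (swap F) L L' & [disjoint L' & S].
Proof.
move=> + + nbrP; have [n] := ubnP #|L :&: S|; elim: n L => // n IHn L.
rewrite ltnS => le_n L_kcl L_F; have [LS0 | [x]] := set_0Vmem (L :&: S).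
  by exists L; rewrite ?connect0 // -setI_eq0 LS0.
case/setIP=> xL xS; have [u uL /andP[uF uS]] := nbrP L L_kcl L_F.
have L_swap := swap_kclique L_kcl L_F uL uF xL.
have /and5P[/andP[_ L'_kcl] _ L'_F _ _] := L_swap.
have [|L' LL' L'S] := IHn _ _ L'_kcl L'_F.
  apply: leq_trans le_n; apply: proper_card; apply/properP; split.
    apply/subsetP=> y; rewrite !inE => /andP[/orP[/eqP-> | /andP[_ ->]]] //.
    by rewrite (negbTE uS).
  exists x; rewrite !inE ?xL // eqxx xS orbF andbT.
  by apply: contra uS => /eqP <-.
by exists L' => //; apply: connect_trans LL'; apply: connect1.
Qed.

(* Colors propagate along swaps: with [l + 1] colors, the color of one vertex
   of an [l + 1]-clique is determined by the colors of the others. *)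
Lemma swap_same_color F L L' f g x y :
  coloring_off F l.+1 f -> coloring_off F l.+1 g ->
  kclique L -> [disjoint L & F] -> connect (swap F) L L' ->
  x \in L -> y \in L' -> (f y == f x) = (g y == g x).
Proof.
move=> f_col g_col L_kcl L_F.
(* The path is reversed so that the induction first removes the clique containing [y]. *)
rewrite swap_connect_sym => /connectP[p]; elim: p L' y => [|A p IHp] L' y /=.
  move=> _ LE xL; rewrite -LE => yL; have /andP[_ L_cl] := L_kcl.
  rewrite (inj_in_eq (clique_coloring_inj f_col L_cl L_F)) //.
  by rewrite (inj_in_eq (clique_coloring_inj g_col L_cl L_F)).
case/andP=> L'A pathA LE xL yL'.
have {}IHp z : z \in A -> (f z == f x) = (g z == g x).
  by move=> zA; apply: IHp pathA LE xL zA.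
have /and5P[/andP[L'_kcl A_kcl] L'_F A_F U_cl U_card] := L'A.
have [yA | yNA] := boolP (y \in A); first exact: IHp.
have /andP[/eqP cardA A_cl] := A_kcl.
have yA_card : l.+1 <= #|y |: A| by rewrite cardsU1 yNA cardA.
have yA_cl : cliqueb (y |: A).
  by apply: sub_clique U_cl; rewrite setSU ?sub1set.
have yF : y \notin F by rewrite (disjointFr L'_F).
have yA_F : [disjoint y |: A & F].
  rewrite disjoint_sym; apply/disjointP=> z zF /setU1P[zy | zA].
    by rewrite -zy zF in yF.
  by rewrite (disjointFr A_F zA) in zF.
have xF : x \notin F by rewrite (disjointFr L_F).
have propagate h h' : coloring_off F l.+1 h -> coloring_off F l.+1 h' ->
    (forall z, z \in A -> (h z == h x) = (h' z == h' x)) ->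
    h y = h x -> h' y = h' x.
  move=> h_col h'_col hh' hyx; have [h'_lt _] := h'_col.
  (* The color [h' x] occurs on [y |: A]. At a vertex [z] of [A] it would force [h z = h x = h y],
     against injectivity of [h] on this clique. *)
  have [z] := clique_all_colors h'_col yA_cl yA_F yA_card (h'_lt _ xF).
  case/setU1P=> [-> // | zA] /eqP; rewrite -hh' // -hyx => /eqP hzy.
  case/negP: yNA; rewrite -(_ : z = y) //.
  by apply: (clique_coloring_inj h_col yA_cl yA_F) hzy;
     rewrite !inE ?zA ?eqxx ?orbT.
by apply/eqP/eqP; apply: propagate => // z zA; rewrite IHp.
Qed.

End CliqueSwaps.

(** * Graphs that lose exactly [l] colors with every [l]-clique *)

Section KCritical.
Variables (G : sgraph) (l : nat).
Hypothesis l_ge2 : 2 <= l.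
Hypothesis chi_del :
  forall K : {set G}, is_copy_of_K l K -> \chi (del_set K) + l = \chi G.
Implicit Types (F S A B K L P W Z : {set G}) (f g : G -> nat).

(** The equation records that the subtraction does not truncate, in the form required by
    [common_nbr_of_color]. *)
Lemma kclique_coloring K : kclique l K ->
  exists2 f, coloring_off K (\chi G - l) f & \chi G = \chi G - l + #|K|.
Proof.
move=> /kcliqueP K_copy; have [f] := ex_coloring_off K.
have [cardK _] := K_copy.
by rewrite -(chi_del K_copy) addnK cardK; exists f.
Qed.

Lemma card_kclique_nbrs K : kclique l K -> \chi G - l <= #|common_nbrs K|.
Proof. by case/kclique_coloring=> f f_col chiG; apply: card_common_nbrs f_col. Qed.

(* If the common neighbors of an [l]-clique [L] all lie in the clique [W], then
   together with [L] they form a clique on [\chi G] vertices. Otherwise one can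
   swap out of [W], and what is left must color [W]. *)
Lemma clique_number_dichotomy W P :
  kclique l P -> cliqueb W ->
  (exists2 K : {set G}, cliqueb K & \chi G <= #|K|) \/ #|W| <= \chi G - l.
Proof.
move=> P_kcl W_cl.
case: (pickP [pred K : {set G} | cliqueb K & \chi G <= #|K|]) => [K | none].
  by case/andP=> K_cl K_card; left; exists K.
right; have nbrP L : kclique l L -> [disjoint L & (set0 : {set G})] ->
    exists2 u, u \in common_nbrs L & (u \notin (set0 : {set G})) && (u \notin W).
  move=> L_kcl _; have [nbr_W | /subsetPn[u uL uW]] :=
    boolP (common_nbrs L \subset W); last by exists u; rewrite // inE.
  have /andP[/eqP cardL L_cl] := L_kcl.
  have [f _ chiG] := kclique_coloring L_kcl.
  have := none (common_nbrs L :|: L); rewrite /= => /negP[]; apply/andP; split.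
    apply/cliqueP=> x y /setUP[xL|xL] /setUP[yL|yL] xy.
    - by move/cliqueP: W_cl; apply; rewrite ?(subsetP nbr_W).
    - by move/common_nbrsP: xL; apply.
    - by rewrite edge_sym; move/common_nbrsP: yL; apply.
    by move/cliqueP: L_cl; apply.
  rewrite cardsU disjoint_setI0 ?cards0 ?subn0.
    by rewrite chiG leq_add2r card_kclique_nbrs.
  by apply/disjointP=> x /common_nbrs_notin/negP.
have P0 : [disjoint P & (set0 : {set G})].
  by rewrite disjoint_sym disjoints_subset sub0set.
have [L PL LW] := escape P_kcl P0 nbrP.
have [L_kcl _] := connect_swapP PL P_kcl P0.
have [f f_col _] := kclique_coloring L_kcl.
by apply: card_clique_le f_col W_cl _; rewrite disjoint_sym.
Qed.

(** * Chromatic number [2l + 1] without a clique on [l + 2] vertices *)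

Section SmallCliqueNumber.
Hypothesis chiE : \chi G = l.+1 + l.
Hypothesis clique_le : forall W, cliqueb W -> #|W| <= l.+1.

Let chi_subl : \chi G - l = l.+1. Proof. by rewrite chiE addnK. Qed.

(** Two adjacent common neighbors would extend [L] to a clique on [l + 2] vertices. *)
Lemma common_nbrs_inj_clique L W u v :
  kclique l L -> cliqueb W -> u \in common_nbrs L -> v \in common_nbrs L ->
  u \in W -> v \in W -> u = v.
Proof.
move=> /andP[/eqP cardL L_cl] /cliqueP W_cl uL vL uW vW.
apply/eqP; apply: contraT => uv.
have vL_cl := common_nbr_clique L_cl vL.
have u_vL : u \in common_nbrs (v |: L).
  apply/common_nbrsP=> x /setU1P[-> | xL]; first exact: W_cl.
  by move/common_nbrsP: uL; apply.
have := clique_le (common_nbr_clique vL_cl u_vL).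
by rewrite !cardsU1 (common_nbrs_notin u_vL) (common_nbrs_notin vL) cardL ltnn.
Qed.

(** Each of [A] and [B] contains at most one of the at least [l + 1 >= 3] common neighbors. *)
Lemma ex_common_nbr_outside L A B :
  kclique l L -> cliqueb A -> cliqueb B ->
  exists2 u, u \in common_nbrs L & (u \notin A) && (u \notin B).
Proof.
move=> L_kcl A_cl B_cl.
have nbrs_le1 W : cliqueb W -> #|common_nbrs L :&: W| <= 1.
  move=> W_cl; apply/card_le1_eqP=> u v /setIP[uL uW] /setIP[vL vW].
  exact: (common_nbrs_inj_clique L_kcl W_cl).
have [/subsetPn[u uL] | ] := boolP (~~ (common_nbrs L \subset A :|: B)).
  by rewrite inE negb_or; exists u.
rewrite negbK => /setIidPl nbr_AB; have := card_kclique_nbrs L_kcl.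
rewrite chi_subl -nbr_AB setIUr => /leq_trans/(_ (leq_card_setU _ _)).
move=> /leq_trans/(_ (leq_add (nbrs_le1 _ A_cl) (nbrs_le1 _ B_cl))).
by rewrite ltnNge l_ge2.
Qed.

(* Whenever a common neighbor [u] of [Z] is missed by the component, trading a
   vertex of [Z] for [u] frees that vertex and enlarges the component. *)
Lemma ex_saturated_component P :
  kclique l P -> exists Z L,
    [/\ kclique l Z, kclique l L, [disjoint Z & P], [disjoint L & P :|: Z]
      & forall u, u \in common_nbrs Z -> u \notin P ->
          exists2 L', connect (swap l (P :|: Z)) L L' & u \in L'].
Proof.
move=> P_kcl; have /andP[_ P_cl] := P_kcl.
have P0 : [disjoint P & (set0 : {set G})].
  by rewrite disjoint_sym disjoints_subset sub0set.
(* Escaping from [P], then from [L0] while avoiding [P], yields a first admissible pair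
   [(L0, L1)]. *)
have [L L_kcl _ | L0 PL0 L0_P] := @escape G l set0 P P P_kcl P0.
  have [u uL /andP[uP _]] := ex_common_nbr_outside L_kcl P_cl P_cl.
  by exists u; rewrite // uP inE.
have [L0_kcl _] := connect_swapP PL0 P_kcl P0.
have /andP[_ L0_cl] := L0_kcl.
have [L L_kcl _ | L1 L01 L1_L0] := @escape G l P L0 L0 L0_kcl L0_P.
  exact: ex_common_nbr_outside.
pose admissible (ZL : {set G} * {set G}) :=
  [&& connect (swap l P) L0 ZL.1, connect (swap l P) L0 ZL.2
    & [disjoint ZL.2 & ZL.1]].
pose component (ZL : {set G} * {set G}) :=
  [set L | connect (swap l (P :|: ZL.1)) ZL.2 L].
have ZL0 : admissible (L0, L1) by rewrite /admissible connect0 L01 L1_L0.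
have [[Z L] /and3P[/= L0Z L0L L_Z] ZL_max] :=
  arg_maxnP (fun ZL => #|component ZL|) ZL0.
have [Z_kcl Z_P] := connect_swapP L0Z L0_kcl L0_P.
have [L_kcl L_P] := connect_swapP L0L L0_kcl L0_P.
have disjU A B : [disjoint A & P] -> [disjoint A & B] -> [disjoint A & P :|: B].
  move=> /disjointP A_P /disjointP A_B; apply/disjointP=> x xA /setUP[].
    exact: A_P.
  exact: A_B.
have L_PZ := disjU _ _ L_P L_Z.
exists Z, L; split=> // u uZ uP; have uNZ := common_nbrs_notin uZ.
case: (pickP [pred L' | (L' \in component (Z, L)) && (u \in L')]) => [L'|none].
  by case/andP; rewrite inE; exists L'.
pose M := component (Z, L); have uM A : A \in M -> u \notin A.
  by move=> AM; have := none A; rewrite /= AM => /negbT.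
have M_off A : A \in M -> kclique l A /\ [disjoint A & P :|: Z].
  by rewrite inE /= => LA; apply: connect_swapP LA L_kcl L_PZ.
have LM : L \in M by rewrite inE connect0.
have ZM : Z \notin M.
  apply/negP=> /M_off[_]; rewrite disjoint_sym disjoints_subset => /subsetP.
  have /andP[/eqP cardZ _] := Z_kcl; have /card_gt0P[z zZ] : 0 < #|Z|.
    by rewrite cardZ (leq_trans _ l_ge2).
  by move=> /(_ z); rewrite !inE zZ orbT => /(_ isT).
have LZ : connect (swap l P) L Z.
  by apply: connect_trans L0Z; rewrite swap_connect_sym.
(* Swaps avoiding [P] lead from [L] to [Z], so one of them leaves the component. Its end [B] must
   meet [Z], and [a] is the vertex of [Z] that it brings in. *)
have [A [B [AM BM AB]]] := connect_exit LZ LM ZM.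
have [A_kcl] := M_off A AM; rewrite disjoint_sym => A_PZ.
have A_Z : [disjoint A & Z].
  by rewrite disjoint_sym; apply: disjointWl A_PZ; apply: subsetUr.
have /and5P[/andP[_ B_kcl] A_P B_P AB_cl AB_card] := AB.
have [a /setIP[aB aZ]] : exists a, a \in B :&: Z.
  apply/set0Pn; apply: contra BM; rewrite setI_eq0 => B_Z; rewrite inE.
  have LA : connect (swap l (P :|: Z)) L A by move: AM; rewrite inE.
  apply: connect_trans LA (connect1 _).
  by rewrite /swap A_kcl B_kcl AB_cl AB_card !disjU.
have aA : a \notin A by rewrite (disjointFl A_Z).
have AB_sub : B \subset a |: A.
  have /andP[/eqP cardA _] := A_kcl.
  have aA_sub : a |: A \subset A :|: B.
    by rewrite [A :|: B]setUC setSU ?sub1set.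
  have /eqP -> : a |: A == A :|: B.
    by rewrite eqEcard aA_sub cardsU1 aA cardA.
  exact: subsetUr.
(* No clique of the component contains [u], so all of them avoid [Z']; so does [B], which lies in
   [a |: A]. Hence the component for [Z'] keeps [M] and gains [B]. *)
pose Z' := u |: (Z :\ a).
have ZZ' : swap l P Z Z' by apply: swap_kclique.
have au : a != u by apply: contraTneq aZ => ->.
have M_Z' C : C \in M -> [disjoint C & Z'].
  move=> CM; have [_ C_PZ] := M_off C CM.
  apply/disjointP=> x xC /setU1P[xu | /setD1P[_ xZ]].
    by have := uM C CM; rewrite -xu xC.
  by have := disjointFr C_PZ xC; rewrite inE xZ orbT.
have B_Z' : [disjoint B & Z'].
  apply/disjointP=> x /(subsetP AB_sub)/setU1P[-> | xA].
    by rewrite !inE eqxx (negbTE au).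
  by rewrite (disjointFr (M_Z' A AM) xA).
have M_PZ' C : C \in M -> [disjoint C & P :|: Z'].
  move=> CM; apply: disjU (M_Z' C CM); have [_] := M_off C CM.
  by rewrite disjoint_sym => C_PZ; rewrite disjoint_sym;
     apply: disjointWl C_PZ; apply: subsetUl.
have sMM' C : C \in M -> connect (swap l (P :|: Z')) L C.
  rewrite inE /= !(swap_connect_sym _ _ L).
  case/connectP=> p; elim: p C => [|D p IHp] C /= => [_ -> //|].
  case/andP=> CD pathD LE; have DM : D \in M.
    by rewrite inE /= swap_connect_sym; apply/connectP; exists p.
  have CM : C \in M.
    move: DM; rewrite !inE /= => /connect_trans; apply; apply: connect1.
    by rewrite swap_sym.
  apply: connect_trans (IHp D pathD LE); apply: connect1.
  have /and5P[CD_kcl _ _ CD_cl CD_card] := CD.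
  by rewrite /swap CD_kcl CD_cl CD_card !M_PZ'.
have ZL' : admissible (Z', L).
  rewrite /admissible /= L0L M_Z' // !andbT.
  by apply: connect_trans L0Z (connect1 ZZ').
have := ZL_max _ ZL'; rewrite /= leqNgt => /negP[]; apply: proper_card.
apply/properP; split; first by apply/subsetP=> C CM; rewrite inE sMM'.
exists B => //; rewrite inE; apply: connect_trans (sMM' A AM) (connect1 _).
rewrite /swap A_kcl B_kcl AB_cl AB_card /= andbT.
by rewrite M_PZ' // disjU.
Qed.

Lemma no_small_clique_number P : ~~ kclique l P.
Proof.
apply/negP=> P_kcl; have /andP[_ P_cl] := P_kcl.
have [Z [L [Z_kcl L_kcl Z_P L_PZ covered]]] := ex_saturated_component P_kcl.
have [f + _] := kclique_coloring P_kcl; rewrite chi_subl => f_col.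
have [g] := kclique_coloring Z_kcl; rewrite chi_subl => g_col chiG.
have /andP[/eqP cardZ Z_cl] := Z_kcl.
have mono u v : u \in common_nbrs Z -> v \in common_nbrs Z ->
    u \notin P -> v \notin P -> g u = g v.
  move=> uZ vZ uP vP; have [L' LL' uL'] := covered u uZ uP.
  have [L'' LL'' vL''] := covered v vZ vP.
  have [L'_kcl L'_PZ] := connect_swapP LL' L_kcl L_PZ.
  have L'L'' : connect (swap l (P :|: Z)) L' L''.
    by apply: connect_trans LL''; rewrite swap_connect_sym.
  (* Both colorings are restricted to the complement of [P :|: Z], where color equality can be
     compared along swaps. *)
  have f_col' := coloring_offS (subsetUl P Z) f_col.
  have g_col' := coloring_offS (subsetUr P Z) g_col.
  have := swap_same_color f_col' g_col' L'_kcl L'_PZ L'L'' uL' vL''.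
  suff -> : f v = f u by rewrite eqxx => /esym/eqP.
  (* All [l + 1] colors of [f] occur on the clique [u |: Z]. As [v] is adjacent to all of [Z], its
     color can only be that of [u]. *)
  have uZ_P : [disjoint u |: Z & P].
    rewrite disjoint_sym; apply/disjointP=> x xP /setU1P[xu | xZ].
      by rewrite -xu xP in uP.
    by rewrite (disjointFr Z_P xZ) in xP.
  have uZ_card : l.+1 <= #|u |: Z|.
    by rewrite cardsU1 (common_nbrs_notin uZ) cardZ.
  have [f_lt f_proper] := f_col.
  have [x] := clique_all_colors f_col (common_nbr_clique Z_cl uZ) uZ_P uZ_card
    (f_lt v vP).
  case/setU1P=> [-> // | xZ] fxv.
  have vx : edge v x by move/common_nbrsP: vZ; apply.
  by case: (f_proper _ _ vP (negbT (disjointFr Z_P xZ)) vx).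
(* Three colors are available because [l + 1 >= 3]. *)
have colored i : i < 3 -> exists2 u, u \in common_nbrs Z & g u = i.
  by move=> lt_i3; apply: common_nbr_of_color chiG g_col _; apply: leq_trans lt_i3 _.
have [u0 u0Z g0] := colored 0 isT.
have [u1 u1Z g1] := colored 1 isT.
have [u2 u2Z g2] := colored 2 isT.
(* Of two differently colored common neighbors exactly one lies in [P], which is impossible for
   three of them pairwise. *)
have in_P u v : u \in common_nbrs Z -> v \in common_nbrs Z -> g u != g v ->
    (u \in P) != (v \in P).
  move=> uZ vZ /eqP guv; case uP: (u \in P); case vP: (v \in P) => //.
    by case: guv; rewrite (common_nbrs_inj_clique Z_kcl P_cl uZ vZ).
  by case: guv; apply: mono; rewrite ?uP ?vP.
have := in_P _ _ u0Z u1Z; have := in_P _ _ u0Z u2Z; have := in_P _ _ u1Z u2Z.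
rewrite g0 g1 g2 => /(_ isT) + /(_ isT) + /(_ isT).
by case: (u0 \in P) (u1 \in P) (u2 \in P) => -[] [].
Qed.

End SmallCliqueNumber.
End KCritical.

(** * From a clique on [\chi G] vertices to completeness *)

Theorem theorem6 (l : nat) (G : sgraph) (l_ge2 : 2 <= l)
  (G_crit : K_critical l G) (chi_le : \chi G <= 2 * l + 1) :
  complete_graph G.
Proof.
case: G_crit => [[P /kcliqueP P_kcl] G_vcrit chi_del].
suff [K K_cl chi_K] : exists2 K : {set G}, cliqueb K & \chi G <= #|K|.
  (* If [K] missed [v], it would be colored within [G - v], which by criticality has only
     [\chi G - 1] colors. *)
  have KT v : v \in K.
    apply: contraT => vK; have [f f_col] := ex_coloring_off [set v].
    have := card_clique_le f_col K_cl; rewrite disjoint_sym disjoints1 vK.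
    move=> /(_ isT) /(leq_trans chi_K).
    by rewrite -(G_vcrit v) addn1 ltnn.
  by move=> x y; move/cliqueP: K_cl; apply.
case: (pickP [pred K : {set G} | cliqueb K & \chi G <= #|K|]) => [K | none].
  by case/andP=> K_cl K_card; exists K.
have small (W : {set G}) : cliqueb W -> #|W| <= \chi G - l.
  move=> W_cl; case: (clique_number_dichotomy chi_del P_kcl W_cl) => // -[K].
  by move=> K_cl chi_K; have := none K; rewrite /= K_cl chi_K.
have /andP[/eqP cardP P_cl] := P_kcl.
have lt_l_chi : l < \chi G.
  by have := none P; rewrite /= P_cl cardP leqNgt => /negbFE.
have [u uP] : exists u, u \in common_nbrs P.
  apply/card_gt0P; apply: leq_trans (card_kclique_nbrs chi_del P_kcl).
  by rewrite subn_gt0.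
(* The [(l + 1)]-clique [u |: P] gives [l + 1 <= \chi G - l], which meets the assumed upper
   bound. *)
have := small _ (common_nbr_clique P_cl uP).
rewrite cardsU1 (common_nbrs_notin uP) cardP => le_chi.
have chiE : \chi G = l.+1 + l.
  apply/eqP; rewrite eqn_leq -{2}(subnK (ltnW lt_l_chi)) leq_add2r le_chi andbT.
  by rewrite addSn addnn -mul2n -addn1.
suff : ~~ kclique l P by rewrite P_kcl.
apply: (no_small_clique_number l_ge2 chi_del chiE) => W /small.
by rewrite chiE addnK.
Qed.
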